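(* Let $\mathfrak A$ be an $\aleph_0$-categorical $L$-structure, where $L$ is a countable first-order language. A relation $R \subseteq A^\ell$ over the universe $A$ of $\mathfrak A$ is positive Horn definable in $\mathfrak A$ if and only if $R$ is preserved by every surjective periomorphism of $\mathfrak A$.
   Context: $L$ may contain relation, constant and function symbols; first-order logic includes equality and a $0$-ary propositional constant $\bot$ always interpreted as false. A positive Horn formula is a first-order formula built from atomic formulas (including equalities and $\bot$) using only $\wedge$, $\exists$, $\forall$. A relation $R\subseteq A^\ell$ is positive Horn definable in $\mathfrak A$ if $R=\{\bar a : \mathfrak A\models\varphi(\bar a)\}$ for some positive Horn formula $\varphi(x_0,\dots,x_{\ell-1})$. A structure is $\aleph_0$-categorical if it is countable and every countable structure satisfying the same first-order sentences is isomorphic to it. A function $\vec a:\mathbb N\to A$ is periodic if there is $k\ge 1$ with $\vec a(i)=\vec a(i \bmod k)$ for all $i$; then we write $\vec a=\langle \vec a(0)\cdots\vec a(k-1)\rangle$. The periodic power $\mathfrak A^{\mathrm{per}}$ is the substructure of the direct power $\mathfrak A^{\mathbb N}$ whose universe $A^{\mathrm{per}}$ is the set of periodic functions (relations, constants and functions interpreted coordinatewise). A periomorphism of $\mathfrak A$ is a homomorphism from $\mathfrak A^{\mathrm{per}}$ to $\mathfrak A$; it is surjective if it is onto $A$. A partial function $h$ from $A^{\mathbb N}$ to $A$ (here with domain $A^{\mathrm{per}}$) preserves $R\subseteq A^\ell$ if whenever $\vec a_0,\dots,\vec a_{\ell-1}$ are in the domain of $h$ and $(\vec a_0(i),\dots,\vec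 a_{\ell-1}(i))\in R$ for all $i\in\mathbb N$, then $(h(\vec a_0),\dots,h(\vec a_{\ell-1}))\in R$. *)

(* Defs.v *)
From mathcomp Require Import all_boot.
From mathcomp Require Import boolp classical_sets functions cardinality.

Set Implicit Arguments.
Unset Strict Implicit.
Unset Printing Implicit Defensive.

Local Open Scope classical_set_scope.

(* Constants are the function symbols of arity 0. *)
Record language := Language {
  relsym : Type;
  rel_arity : relsym -> nat;
  funsym : Type;
  fun_arity : funsym -> nat
}.

Definition countable_language (L : language) : Prop :=
  countable [set: relsym L] /\ countable [set: funsym L].

Record structure (L : language) := Structure {
  carrier :> Type;
  carrier_inhabited : inhabited carrier;
  rel_interp : forall r : relsym L, set ('I_(rel_arity r) -> carrier);
  fun_interp : forall f : funsym L, ('I_(fun_arity f) -> carrier) -> carrier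
}.
Arguments rel_interp {L} s r _.
Arguments fun_interp {L} s f _.

(* [term L n] and [formula L n] have their free variables among x_0, ..., x_{n-1};
   the quantifiers [FAll] and [FEx] bind x_n in a formula over x_0, ..., x_n. *)
Inductive term (L : language) (n : nat) : Type :=
| TVar of 'I_n
| TApp (f : funsym L) of ('I_(fun_arity f) -> term L n).

Inductive formula (L : language) : nat -> Type :=
| FBot n : formula L n
| FEq n of term L n & term L n : formula L n
| FRel n (r : relsym L) of ('I_(rel_arity r) -> term L n) : formula L n
| FAnd n of formula L n & formula L n : formula L n
| FOr n of formula L n & formula L n : formula L n
| FImp n of formula L n & formula L n : formula L n
| FAll n of formula L n.+1 : formula L n
| FEx n of formula L n.+1 : formula L n.

Definition sentence (L : language) := formula L 0.

Section Semantics.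
Variables (L : language) (A : structure L).

Fixpoint eval n (e : 'I_n -> A) (t : term L n) : A :=
  match t with
  | TVar i => e i
  | TApp f ts => fun_interp A f (fun j => eval e (ts j))
  end.

Definition extend n (e : 'I_n -> A) (x : A) (i : 'I_n.+1) : A :=
  if unlift ord_max i is Some j then e j else x.

Fixpoint sat n (phi : formula L n) : ('I_n -> A) -> Prop :=
  match phi in formula _ m return ('I_m -> A) -> Prop with
  | FBot _ => fun=> False
  | FEq _ t u => fun e => eval e t = eval e u
  | FRel _ r ts => fun e => rel_interp A r (fun j => eval e (ts j))
  | FAnd _ p q => fun e => sat p e /\ sat q e
  | FOr _ p q => fun e => sat p e \/ sat q e
  | FImp _ p q => fun e => sat p e -> sat q e
  | FAll _ p => fun e => forall x, sat p (extend e x)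
  | FEx _ p => fun e => exists x, sat p (extend e x)
  end.

Definition no_vars (i : 'I_0) : A := match notF (ltn_ord i) with end.

Definition models (phi : sentence L) : Prop := sat phi no_vars.

End Semantics.

Fixpoint positive_horn L n (phi : formula L n) : bool :=
  match phi with
  | FBot _ | FEq _ _ _ | FRel _ _ _ => true
  | FAnd _ p q => positive_horn p && positive_horn q
  | FOr _ _ _ | FImp _ _ _ => false
  | FAll _ p | FEx _ p => positive_horn p
  end.

Definition positive_horn_definable L (A : structure L) l
    (R : set ('I_l -> A)) : Prop :=
  exists2 phi : formula L l, positive_horn phi & R = [set a | sat phi a].

Definition elementarily_equivalent L (A B : structure L) : Prop :=
  forall phi : sentence L, models A phi <-> models B phi.

Definition homomorphism L (A B : structure L) (h : A -> B) : Prop :=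
  (forall f a, h (fun_interp A f a) = fun_interp B f (h \o a)) /\
  (forall r a, rel_interp A r a -> rel_interp B r (h \o a)).

Definition isomorphism L (A B : structure L) (h : A -> B) : Prop :=
  [/\ bijective h,
      forall f a, h (fun_interp A f a) = fun_interp B f (h \o a) &
      forall r a, rel_interp A r a <-> rel_interp B r (h \o a)].

Definition isomorphic L (A B : structure L) : Prop :=
  exists h : A -> B, isomorphism h.

(* [countable] means finite or countably infinite. *)
Definition aleph0_categorical L (A : structure L) : Prop :=
  countable [set: A] /\
  forall B : structure L, countable [set: B] ->
    elementarily_equivalent A B -> isomorphic A B.

Section Substructure.
Variables (L : language) (A : structure L) (P : set A).
Hypothesis P_nonempty : exists x, P x.
Hypothesis P_closed :
  forall f (a : 'I_(fun_arity f) -> A), (forall j, P (a j)) -> P (fun_interp A f a).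

Lemma substructure_inhabited : inhabited {x | P x}.
Proof. by case: P_nonempty => x Px; exists; exists x. Qed.

Definition substructure : structure L := {|
  carrier := {x | P x};
  carrier_inhabited := substructure_inhabited;
  rel_interp := fun r a => rel_interp A r (fun j => sval (a j));
  fun_interp := fun f a => exist P (fun_interp A f (fun j => sval (a j)))
                             (P_closed (fun j => svalP (a j)))
|}.

End Substructure.

Section PeriodicPower.
Variables (L : language) (A : structure L).

Lemma direct_power_inhabited : inhabited (nat -> A).
Proof. by case: (carrier_inhabited A) => x; exists. Qed.

Definition direct_power : structure L := {|
  carrier := nat -> A;
  carrier_inhabited := direct_power_inhabited;
  rel_interp := fun r a => forall i, rel_interp A r (fun j => a j i);
  fun_interp := fun f a i => fun_interp A f (fun j => a j i)
|}.

Definition periodic (v : nat -> A) : Prop :=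
  exists2 k, 0 < k & forall i, v i = v (i %% k).

Lemma periodic_nonempty : exists v, periodic v.
Proof. by case: (carrier_inhabited A) => x; exists (fun=> x); exists 1. Qed.

Lemma periodic_closed f (a : 'I_(fun_arity f) -> direct_power) :
  (forall j, periodic (a j)) -> periodic (fun_interp direct_power f a).
Proof.
move=> pa; have /choice [k kP] : forall j, exists k,
    0 < k /\ forall i, a j i = a j (i %% k).
  by move=> j; have [k k0 kE] := pa j; exists k.
exists (\prod_j k j) => [|i /=]; first by apply: prodn_gt0 => j; case: (kP j).
congr (fun_interp A f _); apply/funext => j; case: (kP j) => _ kE.
by rewrite kE [RHS]kE modn_dvdm // (bigD1 j) //= dvdn_mulr.
Qed.

Definition periodic_power : structure L :=
  @substructure L direct_power periodic periodic_nonempty periodic_closed.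

Definition periomorphism (h : periodic_power -> A) : Prop := homomorphism h.

Definition preserves l (h : periodic_power -> A) (R : set ('I_l -> A)) : Prop :=
  forall v : 'I_l -> periodic_power,
    (forall i : nat, R (fun j => sval (v j) i)) -> R (h \o v).

End PeriodicPower.

(* Main.v *)
(** Ryll-Nardzewski first: only finitely many n-types are realized in an aleph_0-categorical
    structure A. Conditions are satisfiable definable sets of assignments nat -> A, and a
    generic filter of such sets is the complete diagram of a countable model of Th(A), which
    is A again. Working with sets satisfied in A itself, no proof calculus and no compactness
    theorem is needed: genericity with respect to nonempty sets omits a non-isolated type,
    and genericity with respect to sets meeting infinitely many types realizes a new type.

    Consequently every conjunction of positive Horn formulas is equivalent in A to a positive
    Horn formula. If R is nonempty, let v be a periodic enumeration of representatives in R of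
    all the types meeting R. If a satisfies every positive Horn formula valid on R, then the
    positive Horn type of v is contained in that of a, and a back-and-forth extends v |-> a to
    a surjective homomorphism from the periodic power onto A; hence R a when R is preserved. *)

Require Import Defs.
From mathcomp Require Import all_boot.
From mathcomp Require Import boolp classical_sets functions cardinality.

Set Implicit Arguments.
Unset Strict Implicit.
Unset Printing Implicit Defensive.

Local Open Scope classical_set_scope.

(** * Countability of the set of formulas *)

Lemma countable_inj (T : Type) (U : countType) (f : T -> U) :
  injective f -> countable [set: T].
Proof.
move=> f_inj; apply/countable_injP; exists (pickle \o f) => x y _ _ /=.
by move=> /(pcan_inj pickleK) /f_inj.
Qed.

Lemma countable_code (T : Type) :
  countable [set: T] -> exists f : T -> nat, injective f.
Proof. by move=> /countable_injP [f f_inj]; exists f => x y; apply: f_inj; rewrite inE. Qed.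

Lemma countable_sum (T U : Type) :
  countable [set: T] -> countable [set: U] -> countable [set: T + U].
Proof.
move=> /countable_code [f f_inj] /countable_code [g g_inj].
pose c x : nat + nat := match x with inl x => inl (f x) | inr y => inr (g y) end.
by apply: (countable_inj (f := c)) => -[x|x] [y|y] //= [] => [/f_inj|/g_inj] ->.
Qed.

Lemma countable_tuple (T : Type) n :
  countable [set: T] -> countable [set: 'I_n -> T].
Proof.
move=> /countable_code [f f_inj].
apply: (countable_inj (f := fun v : 'I_n -> T => [ffun i => f (v i)])) => v w.
by move/ffunP => vw; apply/funext => i; apply: f_inj; have := vw i; rewrite !ffunE.
Qed.

Section Coding.
Variables (L : language) (rcode : relsym L -> nat) (fcode : funsym L -> nat).
Hypotheses (rcode_inj : injective rcode) (fcode_inj : injective fcode).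
Local Notation tree := (GenTree.tree nat).

Fixpoint tcode n (t : term L n) : tree :=
  match t with
  | TVar i => GenTree.Leaf (i : nat)
  | TApp f ts => GenTree.Node (fcode f) [seq tcode (ts j) | j <- enum 'I_(fun_arity f)]
  end.

(** The atomic cases store [n], so that a code also determines the number of variables; compound
    formulas inherit it from their subformulas. *)
Fixpoint fmcode n (phi : formula L n) : tree :=
  match phi with
  | FBot n => GenTree.Node 0 [:: GenTree.Leaf n]
  | FEq n t u => GenTree.Node 1 [:: GenTree.Leaf n; tcode t; tcode u]
  | FRel n r ts => GenTree.Node 2 [:: GenTree.Leaf n, GenTree.Leaf (rcode r) &
                     [seq tcode (ts j) | j <- enum 'I_(rel_arity r)]]
  | FAnd _ p q => GenTree.Node 3 [:: fmcode p; fmcode q]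
  | FOr _ p q => GenTree.Node 4 [:: fmcode p; fmcode q]
  | FImp _ p q => GenTree.Node 5 [:: fmcode p; fmcode q]
  | FAll _ p => GenTree.Node 6 [:: fmcode p]
  | FEx _ p => GenTree.Node 7 [:: fmcode p]
  end.

Lemma map_enum_inj (T : Type) m (u v : 'I_m -> T) :
  [seq u j | j <- enum 'I_m] = [seq v j | j <- enum 'I_m] -> forall j, u j = v j.
Proof.
by move=> /eq_in_map uv j; apply: uv; rewrite mem_enum.
Qed.

Lemma tcode_inj n : injective (@tcode n).
Proof.
elim=> [i|f ts IH] [j|g us] //=; first by case=> /val_inj ->.
case=> /fcode_inj fg; case: g / fg us => us /map_enum_inj tu.
by congr TApp; apply/funext => j; apply/IH/tu.
Qed.

(** Formulas over different numbers of variables are compared as dependent pairs. Since the index is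
    a natural number, the resulting cast can be erased by uniqueness of equality proofs. *)
Lemma existT_inv (P : nat -> Type) n (p : P n) m (q : P m) :
  existT P n p = existT P m q -> exists e : n = m, q = ecast k (P k) e p.
Proof.
move=> pq; pose Q x := exists e : n = projT1 x, projT2 x = ecast k (P k) e p.
have: Q (existT P n p) by exists erefl.
by rewrite pq.
Qed.

Arguments existT_inv {P n p m q}.

Lemma fmcode_inj n (phi : formula L n) m (psi : formula L m) :
  fmcode phi = fmcode psi -> existT (formula L) n phi = existT (formula L) m psi.
Proof.
have same k (p q : formula L k) : existT (formula L) k p = existT _ k q -> q = p.
  by case/existT_inv => e ->; rewrite (eq_irrelevance e erefl).
elim: phi m psi => {n} [n|n t u|n r ts|n p IHp q IHq|n p IHp q IHq|n p IHp q IHq|n p IHp|n p IHp]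
  m [k|k t' u'|k r' ts'|k p' q'|k p' q'|k p' q'|k p'|k p'] //=.
- by case=> ->.
- by case=> nk; case: k / nk t' u' => t' u' /tcode_inj -> /tcode_inj ->.
- case=> nk; case: k / nk ts' => ts' /rcode_inj rr; case: r' / rr ts' => ts'.
  move=> /map_enum_inj tt; congr (existT _ _ (FRel _)).
  by apply/funext => j; apply/tcode_inj/tt.
- by case=> /IHp/existT_inv [e ->] /IHq; case: k / e p' q' => p' q' /same ->.
- by case=> /IHp/existT_inv [e ->] /IHq; case: k / e p' q' => p' q' /same ->.
- by case=> /IHp/existT_inv [e ->] /IHq; case: k / e p' q' => p' q' /same ->.
- case=> /IHp/existT_inv [e pp]; have nk : n = k by case: (e).
  by case: k / nk p' e pp => p' e ->; rewrite (eq_irrelevance e erefl).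
- case=> /IHp/existT_inv [e pp]; have nk : n = k by case: (e).
  by case: k / nk p' e pp => p' e ->; rewrite (eq_irrelevance e erefl).
Qed.
End Coding.

Lemma countable_formulas (L : language) :
  countable_language L -> countable [set: {n & formula L n}].
Proof.
case=> /countable_code [rc rc_inj] /countable_code [fc fc_inj].
apply: (countable_inj (f := fun x : {n & formula L n} => fmcode rc fc (projT2 x))).
by move=> [n p] [m q] /(fmcode_inj rc_inj fc_inj).
Qed.

(** The natural numbers serve as Henkin constants, substituted for the variables of a formula. *)
Definition named_formula (L : language) := {n & (formula L n * ('I_n -> nat))%type}.

Lemma countable_named_formulas (L : language) :
  countable_language L -> countable [set: named_formula L].
Proof.
move=> /countable_formulas/countable_code [f f_inj].
pose code (x : named_formula L) :=
  (f (existT _ (projT1 x) (projT2 x).1), [seq (projT2 x).2 i | i <- enum 'I_(projT1 x)]).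
apply: (countable_inj (f := code)) => -[n [p s]] [m [q t]] /= [] /f_inj pq.
have [e ->] := existT_inv pq; case: m / e {q pq} t => t /map_enum_inj st.
by have -> : s = t by apply/funext.
Qed.

(** * Renaming and block quantification *)

Definition snoc (T : Type) n (e : 'I_n -> T) (x : T) (i : 'I_n.+1) : T :=
  if unlift ord_max i is Some j then e j else x.

Lemma extendE L (A : structure L) n (e : 'I_n -> A) x : extend e x = snoc e x.
Proof. by []. Qed.

Lemma comp_snoc (T U : Type) (f : T -> U) n (e : 'I_n -> T) x :
  f \o snoc e x = snoc (f \o e) (f x).
Proof. by apply/funext => i; rewrite /snoc /=; case: unlift. Qed.

Lemma snoc_max (T : Type) n (e : 'I_n -> T) x : snoc e x ord_max = x.
Proof. by rewrite /snoc unlift_none. Qed.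

Lemma snoc_lift (T : Type) n (e : 'I_n -> T) x i : snoc e x (lift ord_max i) = e i.
Proof. by rewrite /snoc liftK. Qed.

Lemma snocP (T : Type) n (f g : 'I_n.+1 -> T) :
  f ord_max = g ord_max -> (forall i, f (lift ord_max i) = g (lift ord_max i)) -> f = g.
Proof. by move=> fgm fgl; apply/funext => i; case: (unliftP ord_max i) => [j ->|->]. Qed.

Fixpoint trename L n m (s : 'I_n -> 'I_m) (t : term L n) : term L m :=
  match t with
  | TVar i => TVar L (s i)
  | TApp f ts => TApp (fun j => trename s (ts j))
  end.

Fixpoint rename L n (phi : formula L n) : forall m, ('I_n -> 'I_m) -> formula L m :=
  match phi in formula _ k return forall m, ('I_k -> 'I_m) -> formula L m with
  | FBot n => fun m _ => FBot L m
  | FEq n t u => fun m s => FEq (trename s t) (trename s u)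
  | FRel n r ts => fun m s => FRel (fun j => trename s (ts j))
  | FAnd _ p q => fun m s => FAnd (rename p s) (rename q s)
  | FOr _ p q => fun m s => FOr (rename p s) (rename q s)
  | FImp _ p q => fun m s => FImp (rename p s) (rename q s)
  | FAll _ p => fun m s => FAll (rename p (snoc (lift ord_max \o s) ord_max))
  | FEx _ p => fun m s => FEx (rename p (snoc (lift ord_max \o s) ord_max))
  end.

Section Semantics.
Variables (L : language).

Lemma eval_rename (A : structure L) n m (s : 'I_n -> 'I_m) e (t : term L n) :
  eval (A := A) e (trename s t) = eval (e \o s) t.
Proof. by elim: t => //= f ts IH; congr fun_interp; apply/funext => j; apply: IH. Qed.

Lemma sat_rename (A : structure L) n (phi : formula L n) m (s : 'I_n -> 'I_m) (e : 'I_m -> A) :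
  sat (rename phi s) e <-> sat phi (e \o s).
Proof.
have ex n' m' (s' : 'I_n' -> 'I_m') (e' : 'I_m' -> A) x :
    extend e' x \o snoc (lift ord_max \o s') ord_max = extend (e' \o s') x.
  rewrite extendE comp_snoc snoc_max extendE; congr snoc.
  by apply/funext => i /=; rewrite snoc_lift.
elim: phi m s e => {n} /=.
- by [].
- by move=> n t u m s e; rewrite !eval_rename.
- move=> n r ts m s e; suff -> : (fun j => eval e (trename s (ts j))) =
    (fun j => eval (e \o s) (ts j)) by [].
  by apply/funext => j; rewrite eval_rename.
- by move=> n p IHp q IHq m s e; rewrite IHp IHq.
- by move=> n p IHp q IHq m s e; rewrite IHp IHq.
- by move=> n p IHp q IHq m s e; rewrite IHp IHq.
- by move=> n p IH m s e; split=> H x; have := H x; rewrite IH ex.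
- by move=> n p IH m s e; split=> -[x H]; exists x; move: H; rewrite IH ex.
Qed.

Lemma eval_hom (A B : structure L) (h : A -> B)
    (h_fun : forall f a, h (fun_interp A f a) = fun_interp B f (h \o a))
    n (t : term L n) (e : 'I_n -> A) :
  h (eval e t) = eval (h \o e) t.
Proof.
elim: t => //= f ts IH; rewrite h_fun; congr fun_interp.
by apply/funext => j; apply: IH.
Qed.

Lemma sat_iso (A B : structure L) (h : A -> B) (h_iso : isomorphism h)
    n (phi : formula L n) (e : 'I_n -> A) :
  sat phi e <-> sat phi (h \o e).
Proof.
case: h_iso => -[g hK gK] h_fun h_rel; have ev := eval_hom h_fun.
elim: phi e => {n} /=.
- by [].
- by move=> n t u e; rewrite -!ev; split=> [->|/(can_inj hK)].
- move=> n r ts e; rewrite h_rel; suff -> : (h \o (fun j => eval e (ts j))) =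
    (fun j => eval (h \o e) (ts j)) by [].
  by apply/funext => j; rewrite -ev.
- by move=> n p IHp q IHq e; rewrite IHp IHq.
- by move=> n p IHp q IHq e; rewrite IHp IHq.
- by move=> n p IHp q IHq e; rewrite IHp IHq.
- move=> n p IH e; split=> H x.
    by have := H (g x); rewrite IH !extendE comp_snoc gK.
  by rewrite IH extendE comp_snoc; apply: H.
- move=> n p IH e; split=> -[x].
    by rewrite IH extendE comp_snoc => H; exists (h x).
  by move=> H; exists (g x); rewrite IH extendE comp_snoc gK.
Qed.

Definition fnot n (phi : formula L n) := FImp phi (FBot L n).

(** Truth as a positive Horn formula; the quantifier supplies a variable even when [n] is 0. *)
Definition ftrue n : formula L n := FAll (FEq (TVar L ord_max) (TVar L ord_max)).

Definition bigand n (I : Type) (s : seq I) (phi : I -> formula L n) : formula L n :=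
  foldr (fun i => FAnd (phi i)) (ftrue n) s.

Lemma sat_bigand (A : structure L) n (I : finType) (phi : I -> formula L n) (e : 'I_n -> A) :
  sat (bigand (enum I) phi) e <-> forall i, sat (phi i) e.
Proof.
suff H (s : seq I) : sat (bigand s phi) e <-> forall i, i \in s -> sat (phi i) e.
  by rewrite H; split=> K i; [apply: K; rewrite mem_enum|move=> _; apply: K].
elim: s => [|i s IH] //=; rewrite IH; split.
  by case=> pi ps j; rewrite inE => /orP[/eqP ->|/ps].
by move=> K; split=> [|j js]; apply: K; rewrite inE ?eqxx ?js ?orbT.
Qed.

Fixpoint exs k n : formula L (k + n) -> formula L n :=
  match k return formula L (k + n) -> formula L n with
  | 0 => id
  | k'.+1 => fun phi => @exs k' n (FEx phi)
  end.

Definition upd (T : Type) (s : nat -> T) k x : nat -> T :=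
  fun i => if i == k then x else s i.

(** Packing all values into one infinite sequence avoids casts between the index types of the
    successive quantifiers. *)
Lemma sat_exs (A : structure L) k n (phi : formula L (k + n)) (e : 'I_n -> A) :
  sat (exs phi) e <->
  exists2 s : nat -> A, (forall i : 'I_n, s i = e i) & sat phi (fun i => s i).
Proof.
elim: k phi => [|k IH] /= phi.
  have [a] := carrier_inhabited A; split=> [H|[s se]].
    exists (fun i => if insub i is Some j then e j else a).
      by move=> i; rewrite valK.
    suff -> : (fun i : 'I_(0 + n) => if insub (val i) is Some j then e j else a) = e by [].
    by apply/funext => i; rewrite valK.
  suff -> : (fun i : 'I_(0 + n) => s i) = e by [].
  exact/funext.
rewrite IH /=; split=> -[s se].
  case=> x H; exists (upd s (k + n) x).
    by move=> i; rewrite /upd -se ifN // neq_ltn ltn_addl.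
  suff -> : (fun i : 'I_(k.+1 + n) => upd s (k + n) x i) = extend (fun i : 'I_(k + n) => s i) x by [].
  apply: snocP; first by rewrite extendE snoc_max /upd eqxx.
  by move=> i; rewrite extendE snoc_lift /upd lift_max ltn_eqF.
move=> H; exists s => //; exists (s (k + n)).
suff <- : (fun i : 'I_(k.+1 + n) => s i) = extend (fun i : 'I_(k + n) => s i) (s (k + n)) by [].
apply: snocP; first by rewrite extendE snoc_max.
by move=> i; rewrite extendE snoc_lift lift_max.
Qed.

End Semantics.

(** * Sets of assignments named by formulas *)

(** The Rasiowa-Sikorski argument: countably many dense requirements are met one after another, the
    requirement with code [k] at stage [k.+1]. *)
Lemma generic_chain (T I : Type) (le : T -> T -> Prop) (cond : T -> Prop)
    (Q : I -> T -> Prop) (x0 : T) :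
  (forall x, le x x) -> (forall x y z, le x y -> le y z -> le x z) ->
  countable [set: I] -> cond x0 ->
  (forall i x, cond x -> exists y, [/\ cond y, le x y & Q i y]) ->
  exists x : nat -> T, [/\ x 0 = x0, forall m n, m <= n -> le (x m) (x n),
    forall n, cond (x n) & forall i, exists n, Q i (x n)].
Proof.
move=> le_refl le_trans /countable_code [c c_inj] x0P dense.
have /choice [f fP] : forall p : nat * T, exists y, cond p.2 ->
    [/\ cond y, le p.2 y & forall i, c i = p.1 -> Q i y].
  case=> k x /=; have [[i ik]|nk] := pselect (exists i, c i = k).
    have [cx|ncx] := pselect (cond x); last by exists x => /ncx.
    have [y [cy xy Qy]] := dense i x cx; exists y => _; split=> // j.
    by rewrite -ik => /c_inj ->.
  by exists x => cx; split=> // i ik; case: nk; exists i.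
pose x := fix x n := if n is n'.+1 then f (n', x n') else x0.
have cx n : cond (x n) by elim: n => //= n IH; case: (fP (n, x n) IH).
exists x; split=> // [m n mn|i].
  rewrite -(subnK mn); elim: (n - m) => [|k IH]; first exact: le_refl.
  by apply: (le_trans _ _ _ IH); case: (fP (k + m, x (k + m)) (cx _)).
by exists (c i).+1; case: (fP (c i, x (c i)) (cx _)) => _ _; apply.
Qed.

Section Named.
Variables (L : language) (A : structure L).

Definition named n (phi : formula L n) (sigma : 'I_n -> nat) : set (nat -> A) :=
  [set s : nat -> A | sat phi (s \o sigma)].

Definition definable (D : set (nat -> A)) : Prop :=
  exists n (phi : formula L n) sigma, D = named phi sigma.

Lemma named_definable n (phi : formula L n) sigma : definable (named phi sigma).
Proof. by exists n, phi, sigma. Qed.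

Lemma namedN n (phi : formula L n) sigma : named (fnot phi) sigma = ~` named phi sigma.
Proof. by []. Qed.

Lemma definableC D : definable D -> definable (~` D).
Proof. by case=> n [phi [sigma ->]]; rewrite -namedN; apply: named_definable. Qed.

Lemma definableT : definable setT.
Proof.
exists 0, (ftrue L 0), (fun i : 'I_0 => match notF (ltn_ord i) with end).
by apply/seteqP; split=> s.
Qed.

Lemma definableI D E : definable D -> definable E -> definable (D `&` E).
Proof.
case=> n [phi [sigma ->]] [m [psi [tau ->]]].
exists (n + m), (FAnd (rename phi (@lshift n m)) (rename psi (@rshift n m))).
exists (fun i : 'I_(n + m) => match fintype.split i with inl j => sigma j | inr j => tau j end).
set r := (X in _ = named _ X).
have rl : r \o @lshift n m = sigma by apply/funext => i; rewrite /r /= (unsplitK (inl i)).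
have rr : r \o @rshift n m = tau by apply/funext => i; rewrite /r /= (unsplitK (inr i)).
by rewrite -{1}rl -{1}rr; apply/seteqP; split=> s; rewrite /named /= !sat_rename.
Qed.

Lemma leq_bound n (f : 'I_n -> nat) : exists N, forall i, f i < N.
Proof. by exists (\max_i f i).+1 => i; rewrite ltnS leq_bigmax. Qed.

Lemma definable_fresh D : definable D ->
  exists N, forall k x s, N <= k -> D (upd s k x) <-> D s.
Proof.
case=> n [phi [sigma ->]]; have [N sN] := leq_bound sigma.
exists N => k x s Nk; rewrite /named /=.
suff -> : upd s k x \o sigma = s \o sigma by [].
by apply/funext => i; rewrite /upd /= ltn_eqF // (leq_trans (sN i)).
Qed.

(* In the formula below x_0, ..., x_(n-1) is the tuple of the image, and x_(n+i) is the
   value of the assignment at i. *)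
Lemma definable_image D n (tau : 'I_n -> nat) : definable D ->
  exists theta : formula L n, forall e, sat theta e <-> exists2 s, D s & e = s \o tau.
Proof.
case=> m [phi [sigma ->]]; have [N1 sN] := leq_bound sigma; have [N2 tN] := leq_bound tau.
pose N := (N1 + N2).+1.
have bs i : n + sigma i < N + n.
  by rewrite /N addnC ltn_add2r ltnS ltnW // (leq_trans (sN i)) ?leq_addr.
have bt i : n + tau i < N + n.
  by rewrite /N addnC ltn_add2r ltnS ltnW // (leq_trans (tN i)) ?leq_addl.
have bi (i : 'I_n) : i < N + n by rewrite ltn_addl.
exists (exs (k := N) (FAnd (rename phi (fun i => Ordinal (bs i)))
  (bigand (enum 'I_n) (fun i => FEq (TVar L (Ordinal (bi i))) (TVar L (Ordinal (bt i))))))).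
move=> e; rewrite sat_exs /=; split=> -[s se].
  rewrite sat_rename sat_bigand /= => -[sphi st].
  exists (fun i => s (n + i)) => //; apply/funext => i /=.
  by rewrite -se st.
move=> es; exists (fun i => if insub i is Some j then e j else s (i - n)).
  by move=> i; rewrite valK.
have hi i : insub (n + i) = None :> option 'I_n by rewrite insubF // ltnNge leq_addr.
rewrite sat_rename sat_bigand /=; split=> [|i]; last by rewrite valK hi addKn es.
set r := (_ \o _); suff -> : r = s \o sigma by [].
by apply/funext => i; rewrite /r /= hi addKn.
Qed.
End Named.

(** * The term model of a Henkin filter *)

Definition proper_filter (T : Type) (F : set (set T)) : Prop :=
  [/\ F setT, forall D E, D `<=` E -> F D -> F E,
      forall D E, F D -> F E -> F (D `&` E) & ~ F set0].

Section HenkinModel.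
Variables (L : language) (A : structure L) (F : set (set (nat -> A))).
Hypothesis F_filter : proper_filter F.
Hypothesis F_decides : forall n (phi : formula L n) sigma,
  F (named phi sigma) \/ F (~` named phi sigma).
Hypothesis F_witness : forall n (phi : formula L n.+1) sigma,
  F (named (FEx phi) sigma) -> exists k, F (named phi (snoc sigma k)).

Lemma F_T : F setT. Proof. by case: F_filter. Qed.

Lemma F_up D E : D `<=` E -> F D -> F E.
Proof. by case: F_filter => _ up _ _; apply: up. Qed.

Lemma F_I D E : F D -> F E -> F (D `&` E).
Proof. by case: F_filter => _ _ I _; apply: I. Qed.

Lemma F_0 : ~ F set0. Proof. by case: F_filter. Qed.

Lemma F_forall (I : finType) (D : I -> set (nat -> A)) :
  (forall i, F (D i)) -> F [set s | forall i, D i s].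
Proof.
move=> FD; suff H (r : seq I) : F [set s | forall i, i \in r -> D i s].
  by apply: F_up (H (enum I)) => s Hs i; apply: Hs; rewrite mem_enum.
elim: r => [|i r IH]; first by apply: F_up F_T.
apply: F_up (F_I (FD i) IH) => s [Di Dr] j.
by rewrite inE => /orP[/eqP ->|/Dr].
Qed.

Definition name_eq (i j : nat) : Prop := F [set s | s i = s j].

Lemma name_eq_refl i : name_eq i i.
Proof. by apply: F_up F_T. Qed.

Lemma name_eq_sym i j : name_eq i j -> name_eq j i.
Proof. by apply: F_up => s /= ->. Qed.

Lemma name_eq_trans i j k : name_eq i j -> name_eq j k -> name_eq i k.
Proof. by move=> ij jk; apply: F_up (F_I ij jk) => s /= [-> ->]. Qed.

(** The quotient by [name_eq] is built from chosen representatives: equivalent names have the same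
    class, hence the same chosen element. *)
Definition repr_name (i : nat) : nat := xget 0 [set j | name_eq i j].

Lemma repr_nameP i : name_eq i (repr_name i).
Proof. by apply: (@xgetPex _ 0 [set j | name_eq i j]); exists i; apply: name_eq_refl. Qed.

Lemma repr_name_eq i j : name_eq i j -> repr_name i = repr_name j.
Proof.
move=> ij; congr xget; apply/seteqP; split=> k /=; first exact/name_eq_trans/name_eq_sym.
exact: name_eq_trans.
Qed.

Definition name_class := {i | repr_name i = i}.

Definition class_of (i : nat) : name_class :=
  exist _ (repr_name i) (esym (repr_name_eq (repr_nameP i))).

Lemma class_ofK (b : name_class) : class_of (sval b) = b.
Proof. by case: b => i ri; apply: eq_exist => /=. Qed.

Lemma class_of_eq i j : class_of i = class_of j <-> name_eq i j.
Proof.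
split=> [[ij]|ij]; last by apply: eq_exist; apply: repr_name_eq.
apply: name_eq_trans (repr_nameP i) _; rewrite ij; exact/name_eq_sym/repr_nameP.
Qed.

(** A name that the filter identifies with the value of [f]; it is the witness for the formula
    stating that this value exists. *)
Definition value_name f (a : 'I_(fun_arity f) -> name_class) : nat :=
  xget 0 [set m | F [set s | s m = fun_interp A f (fun j => s (sval (a j)))]].

Lemma value_nameP f (a : 'I_(fun_arity f) -> name_class) :
  F [set s | s (value_name a) = fun_interp A f (fun j => s (sval (a j)))].
Proof.
apply: (@xgetPex _ 0 [set m | F [set s | s m = fun_interp A f (fun j => s (sval (a j)))]]).
pose phi : formula L (fun_arity f).+1 :=
  FEq (TVar L ord_max) (TApp (fun j => TVar L (lift ord_max j))).
have [|k Fk] := F_witness (phi := phi) (sigma := fun j => sval (a j)).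
  apply: F_up F_T => s _; rewrite /named /=.
  exists (fun_interp A f (fun j => s (sval (a j)))).
  rewrite extendE snoc_max; congr fun_interp; apply/funext => j.
  by rewrite snoc_lift.
exists k; apply: F_up Fk => s; rewrite /named /= snoc_max => ->; congr fun_interp.
by apply/funext => j; rewrite snoc_lift.
Qed.

Definition henkin_model : structure L := {|
  carrier := name_class;
  carrier_inhabited := inhabits (class_of 0);
  rel_interp := fun r a => F [set s | rel_interp A r (fun j => s (sval (a j)))];
  fun_interp := fun f a => class_of (value_name a)
|}.

Let c : nat -> henkin_model := class_of.

Lemma henkin_eval n (t : term L n) (sigma : 'I_n -> nat) :
  F [set s : nat -> A | eval (s \o sigma) t = s (sval (eval (c \o sigma) t))].
Proof.
elim: t => [i|f ts IH] /=; first exact: repr_nameP.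
have E := F_forall IH; set a := fun j => eval _ _ in E *.
have := F_I (F_I E (value_nameP a)) (repr_nameP (value_name a)).
apply: F_up => s /= [[Es Ev]] <-; rewrite Ev; congr fun_interp.
by apply/funext => j; rewrite Es.
Qed.

(** The truth lemma. Deciding every named set handles disjunction and implication; witnesses handle
    the existential quantifier, and the universal one through its negation. *)
Lemma henkin_sat n (phi : formula L n) (sigma : 'I_n -> nat) :
  sat phi (c \o sigma) <-> F (named phi sigma).
Proof.
have neg m (psi : formula L m) tau : F (~` named psi tau) <-> ~ F (named psi tau).
  split=> [FN FP|]; last by case: (F_decides psi tau).
  by apply: F_0; apply: F_up (F_I FN FP) => s [].
have ext m (tau : 'I_m -> nat) (b : henkin_model) :
    extend (c \o tau) b = c \o snoc tau (sval b).
  by rewrite comp_snoc extendE /c class_ofK.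
elim: phi sigma => {n} /=.
- by move=> n sigma; split=> // /F_0.
- move=> n t u sigma; set x := eval _ t; set y := eval _ u.
  have Ft := henkin_eval t sigma; have Fu := henkin_eval u sigma.
  rewrite -(class_ofK x) -(class_ofK y) class_of_eq; split=> H.
    by apply: F_up (F_I H (F_I Ft Fu)) => s [] /= xy [tx uy]; rewrite /named /= tx uy.
  by apply: F_up (F_I H (F_I Ft Fu)) => s [] /= xy [<- <-].
- move=> n r ts sigma; have E := F_forall (fun j => henkin_eval (ts j) sigma).
  split=> H; apply: F_up (F_I H E) => s []; rewrite /named /= => Hs Es.
    suff -> : (fun j => eval (s \o sigma) (ts j)) =
      (fun j => s (sval (eval (c \o sigma) (ts j)))) by [].
    exact/funext.
  suff <- : (fun j => eval (s \o sigma) (ts j)) =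
      (fun j => s (sval (eval (c \o sigma) (ts j)))) by [].
  exact/funext.
- move=> n p IHp q IHq sigma; rewrite IHp IHq; split=> [[]|H]; first exact: F_I.
  by split; apply: F_up H => s [].
- move=> n p IHp q IHq sigma; rewrite IHp IHq; split=> [[]|H].
  + by apply: F_up => s; left.
  + by apply: F_up => s; right.
  have [|Np] := F_decides p sigma; first by left.
  by right; apply: F_up (F_I H Np) => s [[]].
- move=> n p IHp q IHq sigma; rewrite IHp IHq; split=> [H|H Hp].
    have [/H|] := F_decides p sigma; first by apply: F_up => s qs _.
    by apply: F_up => s nps /nps.
  by apply: F_up (F_I H Hp) => s [pq /pq].
- move=> n p IH sigma; split=> [H|H b].
    have [//|] := F_decides (FAll p) sigma => NA.
    have /F_witness [k Fk] : F (named (FEx (fnot p)) sigma).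
      by apply: F_up NA => s; rewrite /named /= => /existsNP.
    have := H (c k); rewrite extendE -comp_snoc IH => Fk'.
    by case: ((neg _ _ _).1 Fk).
  by rewrite ext IH; apply: F_up H => s Hs; rewrite /named /= comp_snoc; apply: Hs.
- move=> n p IH sigma; split=> [[b]|/F_witness [k Fk]].
    rewrite ext IH; apply: F_up => s; rewrite /named /= comp_snoc.
    by exists (s (sval b)).
  by exists (c k); rewrite extendE -comp_snoc IH.
Qed.

End HenkinModel.

(** * Generic filters over a categorical structure *)

Definition decides L (A : structure L) (x : named_formula L) (D : set (nat -> A)) : Prop :=
  let: existT _ (phi, sigma) := x in D `<=` named phi sigma \/ D `<=` ~` named phi sigma.

(* The last name of [x] is irrelevant: the last variable of the formula is the one to be
   witnessed. *)
Definition witnesses L (A : structure L) (x : named_formula L) (D : set (nat -> A)) : Prop :=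
  match x with
  | existT 0 _ => True
  | existT n.+1 (phi, sigma) => let tau := sigma \o lift ord_max in
      D `<=` ~` named (FEx phi) tau \/ exists k, D `<=` named phi (snoc tau k)
  end.

(* Genericity is forced by definable sets outside the ideal [J]. The hypothesis with [upd]
   says that modifying an assignment at a fresh name does not affect smallness, so the
   value of such a name can be used as a witness. The model obtained is countable and
   elementarily equivalent to [A]; categoricity replaces it by [A] itself. *)
Lemma generic_enumeration (L : language) (A : structure L) (I : Type)
    (J : set (set (nat -> A))) (Q : I -> set (nat -> A) -> Prop) (k0 : nat) :
  countable_language L -> aleph0_categorical A -> countable [set: I] ->
  J set0 -> (forall D E, D `<=` E -> J E -> J D) ->
  (forall D E, J D -> J E -> J (D `|` E)) ->
  (forall k D E, k0 <= k -> (forall s, D s -> exists x, E (upd s k x)) -> J E -> J D) ->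
  ~ J setT ->
  (forall i D, definable D -> ~ J D ->
    exists E, [/\ definable E, ~ J E, E `<=` D & Q i E]) ->
  exists F : set (set (nat -> A)), exists c : nat -> A,
    [/\ proper_filter F, forall a, exists k, c k = a,
        forall n (phi : formula L n) sigma, sat phi (c \o sigma) <-> F (named phi sigma) &
        forall i, exists2 E, Q i E & F E].
Proof.
move=> cL [_ catA] cI J0 Jsub JU Jfresh JT dense.
(* As [J] is an ideal, a set outside it keeps a part outside it on at least one side of any cut. *)
have Jsplit D E : ~ J D -> ~ J (D `&` E) \/ ~ J (D `&` ~` E).
  move=> JD; apply/not_andP => -[JE JNE]; apply: JD; rewrite -(setIT D) -(setUv E) setIUr.
  exact: JU.
pose idx := (named_formula L + (named_formula L + I))%type.
pose Q' (i : idx) (D : set (nat -> A)) := match i with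
  | inl x => decides x D | inr (inl x) => witnesses x D | inr (inr i) => Q i D end.
have cidx : countable [set: idx].
  by do 2!(apply: countable_sum; first exact: countable_named_formulas).
have [||||D [_ Dle Dcond DQ]] := @generic_chain (set (nat -> A)) idx
  (fun D E => E `<=` D) (fun D => definable D /\ ~ J D) Q' setT _ _ cidx.
- by move=> X s.
- by move=> X Y Z YX ZY; apply: subset_trans ZY YX.
- by split=> //; apply: definableT.
- case=> [[n [phi sigma]]|[[n [phi sigma]]|i]] D [defD JD].
  + have defE := named_definable A phi sigma.
    have [JE|JE] := Jsplit D (named phi sigma) JD.
      exists (D `&` named phi sigma); split; [|exact: subIsetl|left; exact: subIsetr].
      by split=> //; apply: definableI.
    exists (D `&` ~` named phi sigma); split; [|exact: subIsetl|right; exact: subIsetr].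
    by split=> //; apply: definableI => //; apply: definableC.
  + case: n phi sigma => [|n] phi sigma; first by exists D; split=> // s.
    pose tau := sigma \o lift ord_max.
    have defE := named_definable A (FEx phi) tau.
    have [JE|JE] := Jsplit D (named (FEx phi) tau) JD; last first.
      exists (D `&` ~` named (FEx phi) tau).
      split; [|exact: subIsetl|left; exact: subIsetr].
      by split=> //; apply: definableI => //; apply: definableC.
    set D1 := D `&` _ in JE; have defD1 : definable D1 by apply: definableI.
    have [N D1N] := definable_fresh defD1; have [M tM] := leq_bound tau.
    (* A name that is fresh for the ideal ([k0]), for the set [D1] ([N]) and for the formula
       ([M]). *)
    pose k := k0 + (N + M).
    exists (D1 `&` named phi (snoc tau k)).
    split; [|by move=> s [[]]|right; exists k; exact: subIsetr].
    split; first by apply: definableI => //; apply: named_definable.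
    apply: contra_not JE; apply: (Jfresh k); first exact: leq_addr.
    move=> s D1s; have [_ [x px]] := D1s; exists x; split.
      by apply/D1N => //; rewrite /k addnCA leq_addr.
    rewrite /named /= comp_snoc {2}/upd eqxx.
    suff -> : upd s k x \o tau = s \o tau by [].
    apply/funext => i; rewrite /upd /= ltn_eqF // (leq_trans (tM i)) //.
    by rewrite /k addnA leq_addl.
  + by have [E [defE JE ED QE]] := dense i D defD JD; exists E.
pose F : set (set (nat -> A)) := [set E | exists k, D k `<=` E].
have F_filter : proper_filter F.
  split.
  - by exists 0.
  - by move=> X Y XY [k kX]; exists k; apply: subset_trans kX XY.
  - move=> X Y [k kX] [m mY]; exists (k + m) => s Ds; split.
      by apply: kX; apply: Dle Ds; apply: leq_addr.
    by apply: mY; apply: Dle Ds; apply: leq_addl.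
  - by case=> k k0'; have [_] := Dcond k; apply; apply: Jsub J0.
have F_decides n (phi : formula L n) sigma : F (named phi sigma) \/ F (~` named phi sigma).
  by have [k [H|H]] := DQ (inl (existT _ n (phi, sigma))); [left|right]; exists k.
have F_witness n (phi : formula L n.+1) sigma :
    F (named (FEx phi) sigma) -> exists k, F (named phi (snoc sigma k)).
  (* The 0 is a dummy last name, which [witnesses] discards. *)
  have [k] := DQ (inr (inl (existT _ n.+1 (phi, snoc sigma 0)))).
  rewrite /= (_ : _ \o _ = sigma); last by apply/funext => i /=; rewrite snoc_lift.
  case=> [kN [m mE]|[j kE] _]; last by exists j, k.
  have [_ _ FI F0] := F_filter; case: F0.
  have [j jE] : F (named (FEx phi) sigma `&` ~` named (FEx phi) sigma).
    by apply: FI; [exists m|exists k].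
  by exists j; rewrite -(setICr (named (FEx phi) sigma)).
pose B := henkin_model F_filter.
have satB n (phi : formula L n) sigma :
    sat phi ((fun i => class_of F_filter i : B) \o sigma) <-> F (named phi sigma).
  exact: henkin_sat.
have cB : countable [set: B].
  by apply: (countable_inj (f := fun b : B => sval b)) => x y xy; rewrite -(class_ofK F_filter x) -(class_ofK F_filter y) xy.
have AB : elementarily_equivalent A B.
  (* A sentence defines either all assignments or none. The members of the chain are nonempty, so
     the filter contains exactly the sets of true sentences. *)
  move=> phi; pose o (i : 'I_0) : nat := match notF (ltn_ord i) with end.
  have e0 (C : structure L) (u v : 'I_0 -> C) : u = v.
    by apply/funext => i; case: (notF (ltn_ord i)).
  rewrite /models (e0 B (no_vars B) ((fun i => class_of F_filter i : B) \o o)) satB.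
  have [_ Fup FI F0] := F_filter; split=> [H|[k kE]].
    by exists 0 => s _; rewrite /named /= (e0 A (s \o o) (no_vars A)).
  have [_ JD] := Dcond k; have [s Ds] : exists s, D k s.
    by apply: contrapT => nD; apply: JD; apply: Jsub J0 => s Ds; apply: nD; exists s.
  by have := kE s Ds; rewrite /named /= (e0 A (s \o o) (no_vars A)).
(* Categoricity identifies the term model with [A], and [g] carries the enumeration of classes to
   one of [A]. *)
have [h h_iso] := catA B cB AB; have [[g hK gK] _ _] := h_iso.
exists F, (g \o (fun i => class_of F_filter i : B)); split=> //.
- by move=> a; exists (sval (h a)); rewrite /= (class_ofK F_filter) hK.
- move=> n phi sigma; rewrite -satB (sat_iso h_iso).
  set u := (X in sat phi X <-> _); set v := (X in _ <-> sat phi X).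
  by suff -> : u = v by []; apply/funext => i; rewrite /u /= gK.
- by move=> i; have [k Qk] := DQ (inr (inr i)); exists (D k) => //; exists k.
Qed.

(** * Ryll-Nardzewski *)

Section Types.
Variables (L : language) (A : structure L).
Hypotheses (cL : countable_language L) (catA : aleph0_categorical A).

Definition same_type n (a b : 'I_n -> A) : Prop :=
  forall phi : formula L n, sat phi a <-> sat phi b.

Lemma type_separation n (a b : 'I_n -> A) :
  ~ same_type a b -> exists2 chi : formula L n, sat chi a & ~ sat chi b.
Proof.
move=> /existsNP [phi]; have [pa|npa] := pselect (sat phi a) => ab.
  by exists phi => // pb; apply: ab.
exists (fnot phi) => //= npb; apply: ab; split=> // pb; by case: npb.
Qed.

(* Otherwise the type of [a] could be omitted in a countable model of the theory of [A]. *)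
Lemma type_isolated n (a : 'I_n -> A) :
  exists theta : formula L n, forall b, sat theta b <-> same_type a b.
Proof.
apply: contrapT => /forallNP notiso.
pose Q (sigma : 'I_n -> nat) (E : set (nat -> A)) :=
  exists2 chi : formula L n, sat chi a & E `<=` ~` named chi sigma.
(* Here the ideal contains only the empty set. Each requirement makes the tuple named by [sigma]
   violate a formula true of [a]. *)
have [||||||F [c [[_ Fup FI F0] c_surj Fsat FQ]]] :=
  @generic_enumeration L A _ (fun D => forall s, ~ D s) Q 0 cL catA
    (countable_tuple n (countableP [set: nat])).
- by move=> s.
- by move=> D E DE NE s /DE; apply: NE.
- by move=> D E ND NE s [/ND|/NE].
- by move=> k D E _ DE NE s /DE [x /NE].
- by have [x] := carrier_inhabited A; move/(_ (fun=> x)); apply.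
- move=> sigma D defD ND; have [theta thetaP] := definable_image sigma defD.
  (* [theta] defines the tuples that members of [D] place at [sigma]. If it fails at [a], its
     negation already separates; otherwise, as it does not isolate the type of [a], some tuple in it
     has another type. *)
  have [ta|nta] := pselect (sat theta a); last first.
    exists D; split=> //; exists (fnot theta) => // s Ds; rewrite /named /=; apply.
    by apply/thetaP; exists s.
  have [b tb nab] : exists2 b, sat theta b & ~ same_type a b.
    apply: contrapT => nb; apply: (notiso theta) => b; split=> [tb|ab]; last exact/ab.
    by apply: contrapT => nab; apply: nb; exists b.
  have [chi ca ncb] := type_separation nab; have [s Ds bE] := (thetaP b).1 tb.
  exists (D `&` ~` named chi sigma); split.
  + by apply: definableI => //; apply/definableC/named_definable.
  + by move/(_ s); apply; split=> //; rewrite /named /= -bE.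
  + exact: subIsetl.
  + by exists chi => //; apply: subIsetr.
(* The enumeration is onto [A], so [a] itself is named by some [sigma], whose requirement it
   contradicts. *)
have [sigma sigmaP] := choice (fun i => c_surj (a i)).
have aE : a = c \o sigma by apply/funext => i /=.
have [E [chi ca EN] FE] := FQ sigma; apply: F0.
rewrite aE Fsat in ca; apply: Fup (FI _ _ FE ca) => s [/EN]; by [].
Qed.

(* Otherwise some countable model of the theory of [A] would realize a type that [A]
   does not. *)
Lemma finitely_many_types n :
  exists N, exists r : 'I_N -> 'I_n -> A, forall a, exists j, same_type (r j) a.
Proof.
(* The small sets are those that realize only finitely many types at the names below [n]. Names from
   [n] on do not affect this, whence the bound [n] for fresh names. *)
pose J (D : set (nat -> A)) := exists N, exists r : 'I_N -> 'I_n -> A,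
  forall s, D s -> exists j, same_type (r j) (s \o @nat_of_ord n).
have [x0] := carrier_inhabited A.
suff [N [r rP]] : J setT.
  exists N, r => a; pose s i := if insub i is Some j then a j else x0.
  have [j] := rP s Logic.I; suff -> : s \o @nat_of_ord n = a by exists j.
  by apply/funext => i; rewrite /s /= valK.
apply: contrapT => JT.
pose Q (a : 'I_n -> A) (E : set (nat -> A)) :=
  E `<=` [set s : nat -> A | ~ same_type a (s \o @nat_of_ord n)].
have [|||||F [c [[_ Fup FI F0] _ Fsat FQ]]] :=
  @generic_enumeration L A _ J Q n cL catA (countable_tuple n catA.1) _ _ _ _ JT.
- by exists 0, (fun _ _ => x0).
- by move=> D E DE [N [r rP]]; exists N, r => s /DE; apply: rP.
- move=> D E [N [r rP]] [M [t tP]].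
  exists (N + M), (fun i => match fintype.split i with inl j => r j | inr j => t j end).
  move=> s [/rP [j js]|/tP [j js]].
    by exists (lshift M j); rewrite (unsplitK (inl j)).
  by exists (rshift N j); rewrite (unsplitK (inr j)).
- move=> k D E nk DE [N [r rP]]; exists N, r => s /DE [x /rP [j js]]; exists j.
  suff <- : upd s k x \o @nat_of_ord n = s \o @nat_of_ord n by [].
  by apply/funext => i; rewrite /upd /= ltn_eqF // (leq_trans (ltn_ord i)).
- move=> a D defD JD; have [theta thetaP] := type_isolated a.
  exists (D `&` ~` named theta (@nat_of_ord n)); split.
  + by apply: definableI => //; apply/definableC/named_definable.
  + move=> [N [r rP]]; apply: JD.
    (* Were the rest of [D] small, adding [a] to its representatives would make [D] small. *)
    exists N.+1, (fun i => if unlift ord_max i is Some j then r j else a) => s Ds.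
    have [/thetaP sa|nsa] := pselect (sat theta (s \o @nat_of_ord n)).
      by exists ord_max; rewrite unlift_none.
    by have [//|j js] := rP s; exists (lift ord_max j); rewrite liftK.
  + exact: subIsetl.
  + by move=> s [_ Ns] /thetaP.
(* The tuple named by the first [n] names is a tuple of [A], yet it had to avoid every type realized
   in [A], its own included. *)
pose a := c \o @nat_of_ord n; have [theta thetaP] := type_isolated a.
have [E EN FE] := FQ a; have /Fsat Fa : sat theta a by apply/thetaP.
by apply: F0; apply: Fup (FI _ _ FE Fa) => s [/EN Ns] /thetaP.
Qed.

End Types.

(** * Positive Horn formulas and periodic powers *)

Section Periodic.
Variables (L : language) (A : structure L).
Local Notation Aper := (periodic_power A).

Definition slice n (v : 'I_n -> Aper) (p : nat) : 'I_n -> A := fun j => sval (v j) p.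

Lemma slice_snoc n (v : 'I_n -> Aper) w p : slice (snoc v w) p = snoc (slice v p) (sval w p).
Proof. exact: (comp_snoc (fun u : Aper => sval u p)). Qed.

Lemma eval_slice n (v : 'I_n -> Aper) (t : term L n) p :
  sval (eval v t) p = eval (slice v p) t.
Proof. by rewrite (@eval_hom L Aper A (fun u => sval u p)). Qed.

Lemma common_period n (v : 'I_n -> Aper) :
  exists2 K, 0 < K & forall p, slice v p = slice v (p %% K).
Proof.
have /choice [k kP] : forall j, exists k,
    0 < k /\ forall i, sval (v j) i = sval (v j) (i %% k).
  by move=> j; have [k k0 kE] := svalP (v j); exists k.
exists (\prod_j k j) => [|p]; first by apply: prodn_gt0 => j; case: (kP j).
apply/funext => j; rewrite /slice; case: (kP j) => _ kE.
by rewrite kE [RHS]kE modn_dvdm // (bigD1 j) //= dvdn_mulr.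
Qed.

Lemma periodic_ext (v w : Aper) : (forall p, sval v p = sval w p) -> v = w.
Proof. by case: v w => v pv [w pw] /= vw; apply: eq_exist; apply/funext. Qed.

Lemma periodic_mod K (x : nat -> A) : 0 < K -> periodic (fun p => x (p %% K)).
Proof. by move=> K0; exists K => // i; rewrite modn_mod. Qed.

(** A periodic sequence is determined by the list of its values over one period, the period being
    the length of the list. *)
Lemma countable_periodic_power : countable [set: A] -> countable [set: Aper].
Proof.
move=> /countable_code [g g_inj].
have /choice [k kP] : forall v : Aper, exists k,
    0 < k /\ forall i, sval v i = sval v (i %% k).
  by move=> v; have [k k0 kE] := svalP v; exists k.
apply: (countable_inj (f := fun v : Aper => mkseq (g \o sval v) (k v))) => v w vw.
have kvw : k v = k w by rewrite -(size_mkseq (g \o sval v) (k v)) vw size_mkseq.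
have [kv0 kv] := kP v; have [_ kw] := kP w.
apply: periodic_ext => i; rewrite kv kw -kvw; apply: g_inj.
have im : i %% k v < k v by rewrite ltn_mod.
by move/(congr1 (nth 0 ^~ (i %% k v))): vw; rewrite !nth_mkseq // -kvw.
Qed.

(** Induction on the formula: surjectivity of [h] handles the universal quantifier, and a common
    period of the parameters allows a periodic choice of existential witnesses. *)
Lemma horn_preserved (h : Aper -> A) :
  periomorphism h -> (forall a, exists v, h v = a) ->
  forall n (phi : formula L n) (v : 'I_n -> Aper), positive_horn phi ->
    (forall p, sat phi (slice v p)) -> sat phi (h \o v).
Proof.
move=> [h_fun h_rel] h_surj n phi; have ev := eval_hom h_fun.
elim: phi => {n} [n|n t u|n r ts|n p IHp q IHq|//|//|n p IH|n p IH] v /=.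
- by move=> _ /(_ 0).
- move=> _ tu; rewrite -!ev; congr h.
  by apply: periodic_ext => p; rewrite !eval_slice.
- move=> _ H; have := h_rel r (fun j => eval v (ts j)).
  have -> : h \o (fun j => eval v (ts j)) = (fun j => eval (h \o v) (ts j)).
    by apply/funext => j; rewrite -ev.
  apply=> p; have := H p; suff -> : (fun j => eval (slice v p) (ts j)) =
    (fun j => sval (eval v (ts j)) p) by [].
  by apply/funext => j; rewrite eval_slice.
- move=> /andP[hp hq] H.
  by split; [apply: IHp => // i|apply: IHq => // i]; case: (H i).
- move=> hp H x; have [w <-] := h_surj x.
  by rewrite extendE -comp_snoc; apply: IH => // i; rewrite slice_snoc; apply: H.
- move=> hp /choice [x xP]; have [K K0 vK] := common_period v.
  pose w : Aper := exist _ (fun p => x (p %% K)) (periodic_mod x K0).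
  exists (h w); rewrite extendE -comp_snoc; apply: IH => // i.
  by rewrite slice_snoc /= vK; apply: xP.
Qed.

End Periodic.

(** * Back-and-forth between the periodic power and the structure *)

Section Horn.
Variables (L : language) (A : structure L).
Hypotheses (cL : countable_language L) (catA : aleph0_categorical A).
Local Notation Aper := (periodic_power A).

Lemma rename_horn n (phi : formula L n) m (s : 'I_n -> 'I_m) :
  positive_horn (rename phi s) = positive_horn phi.
Proof.
elim: phi m s => {n} //= n p IHp; first by move=> q IHq m s; rewrite IHp IHq.
Qed.

(** For each of the finitely many types, one member of [X] failing on it is enough to exclude it;
    the conjunction of these members is equivalent to all of [X]. *)
Lemma horn_conj n (X : set (formula L n)) :
  (forall chi, X chi -> positive_horn chi) ->
  exists2 psi : formula L n, positive_horn psi &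
    forall a : 'I_n -> A, sat psi a <-> forall chi, X chi -> sat chi a.
Proof.
move=> Xhorn; have [N [r rP]] := finitely_many_types cL catA n.
have /choice [f fP] : forall j : 'I_N, exists phi : formula L n,
    [/\ positive_horn phi,
        forall a : 'I_n -> A, (forall chi, X chi -> sat chi a) -> sat phi a &
        forall chi, X chi -> sat phi (r j) -> sat chi (r j)].
  move=> j; have [[phi Xphi nphi]|no] := pselect (exists2 phi, X phi & ~ sat phi (r j)).
    by exists phi; split=> [|a|//]; [exact: Xhorn|exact].
  exists (ftrue L n); split=> // chi Xchi _.
  by apply: contrapT => nchi; apply: no; exists chi.
exists (bigand (enum 'I_N) f) => [|a].
  by elim: (enum _) => //= j s ->; rewrite andbT; case: (fP j).
rewrite sat_bigand; split=> [H chi Xchi|H j]; last by case: (fP j) => _ + _; apply.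
have [j ja] := rP a; apply/ja; have [_ _] := fP j; apply=> //; exact/ja.
Qed.

(** The invariant of the back-and-forth. Truth at every position takes the place of satisfaction in
    the periodic power. *)
Definition compat n (e : 'I_n -> Aper * A) : Prop :=
  forall chi : formula L n, positive_horn chi ->
    (forall p, sat chi (slice (fst \o e) p)) -> sat chi (snd \o e).

(** All positive Horn formulas true of the extended tuple at every position amount to a single
    [psi]. Its existential closure holds at every position, with witness the value of [w], and so
    transfers to the images and provides [b]. *)
Lemma compat_forth n (e : 'I_n -> Aper * A) w :
  compat e -> exists b, compat (snoc e (w, b)).
Proof.
move=> ce; pose X chi := positive_horn chi /\
  forall p, sat chi (snoc (slice (fst \o e) p) (sval w p)).
have [|psi psi_horn psiP] := @horn_conj n.+1 X; first by move=> chi [].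
have [|p|b] := ce (FEx psi); first by [].
  by exists (sval w p); rewrite extendE; apply/psiP => chi [].
rewrite extendE => /psiP sb; exists b => chi chi_horn.
rewrite !comp_snoc /= => H; apply: sb; split=> // p.
by have := H p; rewrite slice_snoc.
Qed.

(* A single [w] serves all [b]: writing a position as p = i + j K, with K a period of [e],
   the value of [w] at p makes the tuple at position i realize the j-th type if possible. *)
Lemma compat_back n (e : 'I_n -> Aper * A) b :
  compat e -> exists w, compat (snoc e (w, b)).
Proof.
move=> ce; have [K K0 eK] := common_period (fst \o e).
have [N [r rP]] := finitely_many_types cL catA n.+1.
have [x0] := carrier_inhabited A.
have /choice [f fP] : forall p : nat, exists y, forall j : 'I_N, j = p %/ K %% N :> nat ->
    (exists z, same_type (r j) (snoc (slice (fst \o e) (p %% K)) z)) ->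
    same_type (r j) (snoc (slice (fst \o e) (p %% K)) y).
  move=> p; have [[y [j [jp jy]]]|no] := pselect (exists y, exists j : 'I_N,
      j = p %/ K %% N :> nat /\ same_type (r j) (snoc (slice (fst \o e) (p %% K)) y)).
    by exists y => j' j'p _; rewrite (_ : j' = j) //; apply: val_inj; rewrite /= j'p jp.
  by exists x0 => j jp [z jz]; case: no; exists z, j.
have N0 : 0 < N.
  by have [j _] := rP (fun=> x0); apply: leq_ltn_trans (ltn_ord j).
have KN0 : 0 < K * N by rewrite muln_gt0 K0.
pose w : Aper := exist _ (fun p => f (p %% (K * N))) (periodic_mod f KN0).
exists w => chi chi_horn H; rewrite comp_snoc /=.
(* Proving the universal closure of [chi] makes the choice of [b] irrelevant; by compatibility of
   [e] it is enough to check it at each position. *)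
suff /(_ b) : forall y, sat chi (extend (snd \o e) y) by [].
apply: (ce (FAll chi)) => // p y; have [j jy] := rP (snoc (slice (fst \o e) p) y).
(* At this position [e] has the same slice as at [p], and the value of [w] extends it to a tuple of
   the same type as the extension by [y]. *)
pose q := j * K + p %% K.
have qK : q %% K = p %% K by rewrite /q modnMDl modn_mod.
have qj : q %/ K %% N = j by rewrite /q divnMDl // divn_small ?ltn_mod // addn0 modn_small.
have qKN : q < K * N.
  rewrite /q mulnC; apply: (@leq_trans (K * j + K)); first by rewrite ltn_add2l ltn_mod.
  by rewrite -mulnSr leq_mul2l ltn_ord orbT.
have := H q; rewrite comp_snoc slice_snoc /= eK qK (modn_small qKN) => Hq.
have /(_ _)/(_ chi) [|_ rq] := fP q j (esym qj); first by exists y; rewrite qK -eK.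
by rewrite extendE; apply/jy/rq; rewrite qK.
Qed.

(** The conditions are graphs of finite compatible tuples, and the union of a generic chain of them
    is the graph of the map sought. That it is a function and a homomorphism follows from
    compatibility for atomic formulas. *)
Lemma compat_extend n (e : 'I_n -> Aper * A) :
  compat e -> exists h : Aper -> A, [/\ periomorphism h,
    forall a, exists v, h v = a & forall j, h (e j).1 = (e j).2].
Proof.
move=> ce.
pose graph n (e : 'I_n -> Aper * A) : set (Aper * A) := [set u | exists j, u = e j].
pose cond C := exists n, exists2 e : 'I_n -> Aper * A, C = graph n e & compat e.
pose Q (i : Aper + A) (C : set (Aper * A)) :=
  match i with inl w => exists b, C (w, b) | inr b => exists w, C (w, b) end.
have grow m (d : 'I_m -> Aper * A) u : graph m d `<=` graph m.+1 (snoc d u).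
  by move=> _ [j ->]; exists (lift ord_max j); rewrite snoc_lift.
have new m (d : 'I_m -> Aper * A) u : graph m.+1 (snoc d u) u.
  by exists ord_max; rewrite snoc_max.
have [|||||C [C0 C_le C_cond C_Q]] := @generic_chain (set (Aper * A)) (Aper + A)%type
  (fun C D => C `<=` D) cond Q (graph n e).
- by move=> C u.
- by move=> C D E CD DE; apply: subset_trans CD DE.
- by apply: countable_sum catA.1; apply: countable_periodic_power catA.1.
- by exists n, e.
- move=> i _ [m [d -> cd]]; case: i => [w|b].
    have [b cdb] := compat_forth w cd; exists (graph m.+1 (snoc d (w, b))).
    by split; [exists m.+1, (snoc d (w, b))|exact: grow|exists b; exact: new].
  have [w cdw] := compat_back b cd; exists (graph m.+1 (snoc d (w, b))).
  by split; [exists m.+1, (snoc d (w, b))|exact: grow|exists w; exact: new].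
pose G : set (Aper * A) := [set u | exists k, C k u].
(* Finitely many points of the union lie in one stage of the chain; repetitions and changes of order
   are absorbed by renaming variables. *)
have G_compat m (u : 'I_m -> Aper * A) : (forall j, G (u j)) -> compat u.
  move=> /choice [k kP]; pose M := \max_j k j.
  have [q [d CM cd]] := C_cond M.
  have /choice [s sP] : forall j, exists i, u j = d i.
    move=> j; have : C M (u j) by apply: C_le (kP j); apply: leq_bigmax.
    by rewrite CM.
  have -> : u = d \o s by apply/funext.
  move=> chi chi_horn H; have := cd (rename chi s); rewrite sat_rename; apply.
    by rewrite rename_horn.
  by move=> p; rewrite sat_rename; apply: H.
have /choice [h hP] : forall w, exists b, G (w, b).
  by move=> w; have [k [b Cb]] := C_Q (inl w); exists b, k.
(* Two values at the same [w] agree because the equation between the two variables holds at every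
   position. *)
have G_fun w b : G (w, b) -> h w = b.
  move=> Gwb; pose d (i : 'I_2) := if i == ord0 then (w, h w) else (w, b).
  have cd : compat d by apply: G_compat => j; rewrite /d; case: eqP.
  by have := cd (FEq (TVar L ord0) (TVar L ord_max)) isT; apply=> p.
exists h; split.
- split=> [f a|r a ra].
    pose d := snoc (fun j => (a j, h (a j))) (fun_interp Aper f a, h (fun_interp Aper f a)).
    have cd : compat d.
      by apply: G_compat => j; rewrite /d /snoc; case: unlift => [i|]; apply: hP.
    have /= := cd (FEq (TVar L ord_max) (TApp (fun j => TVar L (lift ord_max j)))) isT.
    rewrite /slice /d /= snoc_max /= => -> => [|p]; last first.
      by congr fun_interp; apply/funext => j /=; rewrite snoc_lift.
    by congr fun_interp; apply/funext => j /=; rewrite snoc_lift.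
  have cd : compat (fun j => (a j, h (a j))) by apply: G_compat => j; apply: hP.
  exact: (cd (FRel (fun j => TVar L j)) isT).
- move=> b; have [k [w Cw]] := C_Q (inr b); exists w; apply: G_fun; by exists k.
- move=> j; apply: G_fun; exists 0; rewrite C0; exists j; by case: (e j).
Qed.

End Horn.

(** * Positive Horn definability and surjective periomorphisms *)

Unset Implicit Arguments.

Theorem theorem6p1 (L : language) (L_countable : countable_language L)
    (A : structure L) (A_categorical : aleph0_categorical A)
    (l : nat) (R : set ('I_l -> A)) :
  positive_horn_definable R <->
  (forall h : periodic_power A -> A,
     periomorphism h -> (forall a : A, exists v, h v = a) -> preserves h R).
Proof.
split=> [[phi phi_horn ->] h h_per h_surj v|R_pres]; first exact: horn_preserved.
(* The candidate definition of [R] is the conjunction of all positive Horn formulas valid on [R]. *)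
pose X (chi : formula L l) := positive_horn chi /\ forall a, R a -> sat chi a.
have [|psi psi_horn psiP] := horn_conj L_countable A_categorical (X := X); first by move=> chi [].
exists psi => //; apply/seteqP; split=> [a Ra|a /= /psiP Xa].
  by apply/psiP => chi [_]; apply.
(* For empty [R] the formula [FBot] would be valid on [R], and no tuple satisfies it. *)
have [r0 Rr0] : exists a, R a.
  by apply: contrapT => R0; apply: (Xa (FBot L l)); split=> // b Rb; case: R0; exists b.
have [[|N] [r rP]] := finitely_many_types L_countable A_categorical l.
  by have [j _] := rP r0; case: (notF (ltn_ord j)).
(* [t j] is a member of [R] of the [j]-th type if there is one, and [r0] otherwise, so that every
   value lies in [R]. *)
have /choice [t tP] : forall j, exists b, R b /\
    ((exists2 c, R c & same_type (r j) c) -> same_type (r j) b).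
  move=> j; have [[c Rc jc]|no] := pselect (exists2 c, R c & same_type (r j) c).
    by exists c.
  by exists r0; split=> // /no.
pose T p := t (inord (p %% N.+1)).
have T_per i : periodic (fun p => T p i).
  by exists N.+1 => // p; rewrite /T modn_mod.
pose v i : periodic_power A := exist _ (fun p => T p i) (T_per i).
(* A formula true at every position of [v] holds at a representative of each type meeting [R], hence
   on all of [R], hence at [a]. *)
have ce : compat (fun i => (v i, a i)).
  move=> chi chi_horn H; apply: Xa; split=> // c Rc; have [j jc] := rP c.
  have [_ jt] := tP j; apply/jc/jt; first by exists c.
  by have := H j; rewrite /slice /= /T modn_small ?inord_val.
have [h [h_per h_surj hv]] := compat_extend L_countable A_categorical ce.
have -> : a = h \o v by apply/funext => i; rewrite -[LHS](hv i).
by apply: R_pres => // p; case: (tP (inord (p %% N.+1))).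
Qed.
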